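(* Consider the DOMT construction described in the context, applied to a base procedure with exploration coefficient $\kappa>0$ and target level $\alpha\in(0,1)$, under the following conditions: (i) null $p$-values are $\mathrm{Uniform}[0,1]$; (ii) the alternative CDF $G$ satisfies $|G(x)-G(y)|\le L|x-y|$ for all $x,y\in[0,1]$, for some $L\ge1$; (iii) there is $\eta>0$ with $\liminf_{T\to\infty}R_T^{\mathrm{base}}/T\ge\eta$ almost surely; (iv) the exploration amplitude is $\epsilon_t=\kappa\alpha/\sqrt t$. If the base procedure satisfies $\limsup_{t\to\infty}\mathrm{FDR}_t^{\mathrm{base}}\le\alpha$, then $\limsup_{t\to\infty}\mathrm{FDR}_t^{\mathrm{DOMT}}\le\alpha$.
   Context: Data model: states $Y_t\in\{0,1\}$; conditionally on the states and the past, $p_t\sim\mathrm{Uniform}[0,1]$ if $Y_t=0$ and $p_t\sim G$ if $Y_t=1$, where $G$ is a continuous strictly increasing CDF on $[0,1]$ with $G(0)=0,G(1)=1$. A base procedure computes at each round $t$ a threshold $\lambda_t^{\mathrm{base}}\in[0,1]$ as a function of the virtual history $(p_s,\lambda_s^{\mathrm{base}},\delta_s^{\mathrm{base}})_{s\le t-1}$, with virtual decisions $\delta_t^{\mathrm{base}}=\mathbf{1}\{p_t\le\lambda_t^{\mathrm{base}}\}$. DOMT (Decoupled-OMT): let $Z_t$ be i.i.d. $\mathrm{Uniform}[0,1]$, independent of everything else, $\epsilon_t=\kappa\alpha/\sqrt t$, $\xi_t=\epsilon_t Z_t$; DOMT uses threshold $\lambda_t=\min(1,\lambda_t^{\mathrm{base}}+\xi_t)$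 and actual decision $\delta_t=\mathbf{1}\{p_t\le\lambda_t\}$, while the base procedure's internal state is updated only with the virtual decisions $\delta_t^{\mathrm{base}}$. For either procedure, $R_t=\sum_{s\le t}\delta_s$ (number of rejections), $V_t=\sum_{s\le t}\mathbf{1}\{Y_s=0,\delta_s=1\}$, $\mathrm{FDP}_t=V_t/\max(1,R_t)$ and $\mathrm{FDR}_t=\mathbb{E}[\mathrm{FDP}_t]$; superscripts base/DOMT indicate which decisions ($\delta^{\mathrm{base}}$ or $\delta$) are used. *)

(* Defs.v *)
From HB Require Import structures.
From mathcomp Require Import all_boot all_order all_algebra.
From mathcomp Require Import all_classical all_reals all_analysis.
Set Implicit Arguments. Unset Strict Implicit. Unset Printing Implicit Defensive.
Import Order.TTheory GRing.Theory Num.Theory.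
Local Open Scope classical_set_scope.
Local Open Scope ring_scope.

Section DOMT.
Variable R : realType.

(* A base procedure: at (0-based) round t, the threshold is computed from the
   virtual history, a list of triples (p_s, lambda_s^base, delta_s^base), s < t. *)
Definition base_proc := nat -> seq (R * R * bool) -> R.

Fixpoint base_hist (base : base_proc) (p : nat -> R) (t : nat) : seq (R * R * bool) :=
  match t with
  | 0 => [::]
  | t'.+1 => let h := base_hist base p t' in
             let l := base t' h in
             rcons h (p t', l, p t' <= l)
  end.

Definition lam_base (base : base_proc) (p : nat -> R) (t : nat) : R :=
  base t (base_hist base p t).

Definition delta_base (base : base_proc) (p : nat -> R) (t : nat) : bool :=
  p t <= lam_base base p t.

(* DOMT threshold at 0-based round t (round number t+1):
   eps = kappa * alpha / sqrt (t+1), lambda = min(1, lambda^base + eps * Z_t) *)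
Definition eps_t (kappa alpha : R) (t : nat) : R :=
  kappa * alpha / Num.sqrt (t.+1)%:R.

Definition lam_domt (base : base_proc) (kappa alpha : R) (p Z : nat -> R) (t : nat) : R :=
  Num.min 1 (lam_base base p t + eps_t kappa alpha t * Z t).

Definition delta_domt (base : base_proc) (kappa alpha : R) (p Z : nat -> R) (t : nat) : bool :=
  p t <= lam_domt base kappa alpha p Z t.

Definition nrej (delta : nat -> bool) (n : nat) : nat := \sum_(s < n) delta s.
Definition nfalse (Y : nat -> bool) (delta : nat -> bool) (n : nat) : nat :=
  \sum_(s < n) ((~~ Y s) && delta s).
Definition FDP (Y : nat -> bool) (delta : nat -> bool) (n : nat) : R :=
  (nfalse Y delta n)%:R / (maxn 1 (nrej delta n))%:R.

End DOMT.

Definition gen_past {T : Type} {R : realType} (Y : nat -> T -> bool) (p : nat -> T -> R)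
  (t : nat) : set (set T) :=
  [set A | exists s b, A = [set w | Y s w = b]] `|`
  [set A | exists s (x : R), (s < t)%N /\ A = [set w | p s w <= x]].

Definition sigma_past {T : Type} {R : realType} (Y : nat -> T -> bool) (p : nat -> T -> R)
  (t : nat) : set (set T) := <<s gen_past Y p t >>.

Definition sigma_all {T : Type} {R : realType} (Y : nat -> T -> bool) (p : nat -> T -> R)
  : set (set T) := <<s \bigcup_t gen_past Y p t >>.

Definition sigma_phist {T : Type} {R : realType} (p : nat -> T -> R) (t : nat)
  : set (set T) :=
  <<s [set A | exists s (x : R), (s < t)%N /\ A = [set w | p s w <= x]] >>.

Arguments FDP {R} Y delta n.

(* Main.v *)
(** With [lambda^base <= lambda^DOMT], DOMT rejects everything the base procedure
    rejects, plus [N_n] extra hypotheses among the first [n], so that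
      [FDP^DOMT <= FDP^base + N_n / (c n) + 1{R^base_n < c n}]
    for [c = eta / 2].  A p-value falls between the two thresholds with probability
    at most of order [L eps_t], whence [E N_n / n -> 0] by Cesaro since
    [eps_t -> 0]; the probability of the last event tends to [0] because
    [liminf R^base_n / n >= eta] almost surely. *)
Require Import Defs.
From HB Require Import structures.
From mathcomp Require Import all_boot all_order all_algebra.
From mathcomp Require Import all_classical all_reals all_analysis.
From mathcomp Require Import measurable_realfun lra.
Set Implicit Arguments. Unset Strict Implicit. Unset Printing Implicit Defensive.
Import Order.TTheory GRing.Theory Num.Theory numFieldNormedType.Exports.
Local Open Scope classical_set_scope.
Local Open Scope ring_scope.

(** * Limits superior and inferior, and probabilities of vanishing events *)

(** The limit superior is the infimum of the tail suprema, so if it is at most [a], some tail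
    supremum lies below [a + e]. The converse lets [e] tend to [0]. *)
Lemma limn_esup_leP (R : realType) (u : nat -> \bar R) (a : R) :
  (limn_esup u <= a%:E)%E <->
  (forall e : R, 0 < e -> \forall n \near \oo, (u n <= (a + e)%:E)%E).
Proof.
rewrite limn_esup_lim (cvg_lim _ (@cvg_esups_inf R u))//; split=> [ua e e0|ua].
  have : (ereal_inf (range (esups u)) < (a + e)%:E)%E.
    by rewrite (le_lt_trans ua)// lte_fin ltrDl.
  move=> /ereal_inf_lt[_ [n _ <-]] /ltW une.
  exists n => // k /= nk; apply: le_trans une.
  by apply: ereal_sup_ubound; exists k.
apply/lee_addgt0Pr => e e0; have [n _ un] := ua e e0.
apply: (@le_trans _ _ (esups u n)); first by apply: ereal_inf_lbound; exists n.
by apply: ge_ereal_sup => _ [k /= nk <-]; rewrite -EFinD; exact: un.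
Qed.

Lemma lt_limn_einf (R : realType) (u : nat -> \bar R) (a : \bar R) :
  (a < limn_einf u)%E -> \forall n \near \oo, (a < u n)%E.
Proof.
rewrite limn_einf_lim (cvg_lim _ (@cvg_einfs_sup R u))//.
move=> /ereal_sup_gt[_ [n _ <-]] aun.
exists n => // k /= nk; apply: (lt_le_trans aun).
by apply: ereal_inf_lbound; exists k.
Qed.

(** Dominated convergence: the indicators of [A n] are bounded by [1] and almost everywhere
    eventually [0]. *)
Lemma probability_eventually_notin_cvg0 (R : realType) (d : measure_display)
    (T : measurableType d) (P : probability T R) (A : nat -> set T) :
  (forall n, measurable (A n)) ->
  {ae P, forall w, \forall n \near \oo, ~ A n w} ->
  (P (A n) @[n --> \oo] --> 0)%E.
Proof.
move=> mA nA; rewrite -(@integral0 _ _ _ P setT).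
rewrite (_ : (fun n => P (A n)) = fun n => (\int[P]_w (\1_(A n) w)%:E)%E); last first.
  by apply/funext => n; rewrite integral_indic// setIT.
have [] := @dominated_convergence _ _ _ P setT measurableT
    (fun n w => (\1_(A n) w)%:E) (cst 0%E) (cst 1%E) => //.
- by move=> n; apply/measurable_EFinP; exact: measurable_indic.
- apply: filterS nA => w nAw _; apply: cvg_near_cst.
  by apply: filterS nAw => n nAwn; rewrite indicE memNset.
- exact: finite_measure_integrable_cst.
- apply: aeW => w n _; rewrite /= lee_fin indicE.
  by case: (_ \in _); rewrite ?normr0 ?normr1.
Qed.

(** * Pathwise comparison of false discovery proportions *)

Section counting.
Variable R : realType.
Implicit Types (Y delta : nat -> bool).

Lemma FDP_ge0 Y delta n : 0 <= FDP Y delta n :> R.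
Proof. by rewrite /FDP divr_ge0. Qed.

Lemma nfalse_le_nrej Y delta n : (nfalse Y delta n <= nrej delta n)%N.
Proof. by apply: leq_sum => i _; case: (Y _) (delta _) => -[]. Qed.

Lemma FDP_le1 Y delta n : FDP Y delta n <= 1 :> R.
Proof.
rewrite /FDP ler_pdivrMr ?ltr0n ?leq_max// mul1r ler_nat.
by rewrite (leq_trans (nfalse_le_nrej _ _ _))// leq_maxr.
Qed.

(** If [delta] rejects fewer than [c] times, the last term is [1] and dominates any FDP. Otherwise
    the extra rejections raise the numerator by at most their number, while the denominator only
    grows and is already at least [c]. *)
Lemma FDP_superset Y delta delta' n (c : R) : 0 < c ->
  (forall s, delta s -> delta' s) ->
  FDP Y delta' n <= FDP Y delta n
    + c^-1 * (\sum_(s < n) (~~ delta s && delta' s)%:R)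
    + ((nrej delta n)%:R < c)%R%:R :> R.
Proof.
move=> c0 dd'.
have N0 : 0 <= \sum_(s < n) (~~ delta s && delta' s)%:R :> R by exact: sumr_ge0.
have [Rc|cR] := ltP; rewrite /= ?addr0.
  by rewrite (le_trans (FDP_le1 _ _ _))// lerDr addr_ge0 ?FDP_ge0// mulr_ge0// invr_ge0 ltW.
set N := \sum_(_ < n) _ in N0 *.
have RR' : (nrej delta n <= nrej delta' n)%N.
  by apply: leq_sum => i _; have := dd' i; case: (delta _) (delta' _) => -[]// /(_ erefl).
have VV' : (nfalse Y delta' n)%:R <= (nfalse Y delta n)%:R + N.
  rewrite /nfalse /N !natr_sum -big_split/=; apply: ler_sum => i _.
  by rewrite -natrD ler_nat; case: (Y _) (delta _) (delta' _) => -[] [].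
have R0 : 0 < (maxn 1 (nrej delta n))%:R :> R by rewrite ltr0n leq_max.
have cR' : c <= (maxn 1 (nrej delta n))%:R.
  by rewrite (le_trans cR)// ler_nat leq_maxr.
apply: (@le_trans _ _ (((nfalse Y delta n)%:R + N) / (maxn 1 (nrej delta n))%:R)).
  rewrite /FDP ler_pM// lef_pV2 ?posrE// ?ltr0n ?leq_max// ler_nat.
  by rewrite geq_max leq_maxl/= leq_max RR' orbT.
rewrite mulrDl lerD2l mulrC ler_wpM2r// lef_pV2 ?posrE//.
Qed.

End counting.

(** * Measurability of rejection counts and of the FDP *)

Section measurability.
Context (R : realType) (d : measure_display) (Omega : measurableType d).
Implicit Types Y delta : nat -> Omega -> bool.

Lemma measurable_sum_nat (n : nat) (f : nat -> Omega -> nat) :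
  (forall i, measurable_fun setT (f i)) ->
  measurable_fun setT (fun w => \sum_(i < n) f i w)%N.
Proof.
move=> mf; elim: n => [|n ih].
  by rewrite (_ : (fun w => _) = cst 0%N)//; apply/funext => w; rewrite big_ord0.
under eq_fun do rewrite big_ord_recr/=.
exact: measurable_fun_addn.
Qed.

Lemma measurable_nat_of_bool (f : Omega -> bool) :
  measurable_fun setT f -> measurable_fun setT (fun w => f w : nat).
Proof. by move=> mf; exact: (@measurableT_comp _ _ _ _ _ _ nat_of_bool). Qed.

Lemma measurable_nrej delta n : (forall s, measurable_fun setT (delta s)) ->
  measurable_fun setT (fun w => nrej (delta ^~ w) n).
Proof.
move=> md; apply: (@measurable_sum_nat n (fun s w => delta s w : nat)) => i.
exact: measurable_nat_of_bool.
Qed.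

Lemma measurable_FDP Y delta n :
  (forall s, measurable_fun setT (Y s)) ->
  (forall s, measurable_fun setT (delta s)) ->
  measurable_fun setT (fun w => FDP (Y ^~ w) (delta ^~ w) n : R).
Proof.
move=> mY md; apply: measurable_funM.
  apply: (@measurableT_comp _ _ _ _ _ _ (fun k : nat => k%:R : R)) => //.
  apply: (@measurable_sum_nat n
    (fun s w => ~~ Y s w && delta s w : nat)) => i.
  apply: measurable_nat_of_bool.
  by apply: measurable_and => //; exact: measurable_neg.
apply: (@measurableT_comp _ _ _ _ _ _ (fun k : nat => (maxn 1 k)%:R^-1 : R)) => //.
exact: measurable_nrej.
Qed.

End measurability.

(** * Conditional law of a p-value and the probability of landing just above the threshold *)

Section data_model.
Context (R : realType) (d : measure_display) (Omega : measurableType d).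
Context (P : probability Omega R).
Context (Y : nat -> Omega -> bool) (p : nat -> Omega -> R).
Hypothesis mY : forall t b, measurable [set w | Y t w = b].
Hypothesis mp : forall t, measurable_fun setT (p t).

Lemma measurable_le_cst (f : Omega -> R) (x : R) : measurable_fun setT f ->
  measurable [set w | f w <= x].
Proof.
move=> mf; rewrite -[X in measurable X]setTI.
rewrite (_ : [set w | _] = f @^-1` [set` `]-oo, x]]).
  exact: mf.
by apply/seteqP; split=> w /=; rewrite in_itv.
Qed.

Lemma measurable_set_bool (f : Omega -> bool) : measurable_fun setT f ->
  measurable [set w | f w].
Proof.
move=> mf; rewrite -[X in measurable X]setTI.
by rewrite (_ : [set w | _] = f @^-1` [set true])//; exact: mf.
Qed.

Lemma measurable_fun_of_le (f : Omega -> R) :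
  (forall x, measurable [set w | f w <= x]) -> measurable_fun setT f.
Proof.
move=> mf; apply: (measurability _ (RGenOInfty.measurableE R)) => //.
move=> _ [_ [x ->] <-]; rewrite setTI.
rewrite (_ : _ @^-1` _ = ~` [set w | f w <= x]); first exact: measurableC.
by apply/seteqP; split=> w /=; rewrite in_itv/= andbT ltNge => /negP.
Qed.

Lemma sigma_past_measurable t (A : set Omega) :
  sigma_past Y p t A -> measurable A.
Proof.
apply: (@smallest_sub _ _ _ measurable).
  exact: sigma_algebra_measurable.
move=> B [[s [b ->]]|[s [x [_ ->]]]]; first exact: mY.
exact: measurable_le_cst.
Qed.

Lemma sub_sigma_phist_past t (A : set Omega) :
  sigma_phist p t A -> sigma_past Y p t A.
Proof. by apply: sub_sigma_algebra2 => B ?; right. Qed.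

Lemma sigma_phist_measurable t (A : set Omega) :
  sigma_phist p t A -> measurable A.
Proof. by move=> /sub_sigma_phist_past; exact: sigma_past_measurable. Qed.

Lemma sigma_phistD t (A B : set Omega) :
  sigma_phist p t A -> sigma_phist p t B -> sigma_phist p t (A `\` B).
Proof.
exact: (@measurableD _ (g_sigma_algebraType
  [set A | exists s (x : R), (s < t)%N /\ A = [set w | p s w <= x]])).
Qed.

Context (G : R -> R) (L : R).
Hypothesis L1 : 1 <= L.
Hypothesis lipG : forall x y : R, 0 <= x <= 1 -> 0 <= y <= 1 ->
  `|G x - G y| <= L * `|x - y|.
Hypothesis model : forall t A (x : R), sigma_past Y p t A -> 0 <= x <= 1 ->
  P (A `&` [set w | p t w <= x]) =
    (x%:E * P (A `&` [set w | Y t w = false]) +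
     (G x)%:E * P (A `&` [set w | Y t w = true]))%E.

(** Subtract the model identity at [x] from the one at [y]. The null part contributes the factor
    [y - x] and the alternative part [G y - G x]; both are at most [L * (y - x)], the first because
    [1 <= L]. *)
Lemma pvalue_in_interval_le t (A : set Omega) (x y : R) :
  sigma_past Y p t A -> 0 <= x -> x <= y -> y <= 1 ->
  (P (A `&` [set w | (x < p t w <= y)%R]) <= (L * (y - x))%:E * P A)%E.
Proof.
move=> sA x0 xy y1.
have mA := sigma_past_measurable sA.
have x01 : 0 <= x <= 1 by rewrite x0 (le_trans xy).
have y01 : 0 <= y <= 1 by rewrite y1 (le_trans x0).
have mle z : measurable [set w | p t w <= z] by exact: measurable_le_cst.
have Dxy : A `&` [set w | x < p t w <= y] =
    (A `&` [set w | p t w <= y]) `\` (A `&` [set w | p t w <= x]).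
  apply/seteqP; split=> w /=.
    by move=> [Aw /andP[xp py]]; split=> // -[_]; rewrite leNgt xp.
  move=> [[Aw py] npx]; split => //; rewrite py andbT ltNge.
  by apply/negP => px; apply: npx.
have PA : P A = (P (A `&` [set w | Y t w = false]) +
                 P (A `&` [set w | Y t w = true]))%E.
  rewrite -measureU; [|exact: measurableI|exact: measurableI|]; last first.
    by apply/seteqP; split => // w /= [[_ ->] [_]].
  by congr (P _); apply/seteqP; split => w /=; [case: (Y t w); tauto|tauto].
have -> : P (A `&` [set w | x < p t w <= y]) =
    (P (A `&` [set w | (p t w <= y)%R]) - P (A `&` [set w | (p t w <= x)%R]))%E.
  rewrite Dxy measureD; [|exact: measurableI|exact: measurableI|]; last first.
    by rewrite -ge0_fin_numE// fin_num_measure//; exact: measurableI.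
  rewrite setIACA setIid (_ : [set w | p t w <= y] `&` _ = [set w | p t w <= x])//.
  by apply/seteqP; split => w /= => [[]//|px]; split => //; exact: le_trans xy.
rewrite (model sA x01) (model sA y01) PA.
set a := P (_ `&` [set w | _ = false]); set b := P (_ `&` _).
have af : a \is a fin_num by rewrite fin_num_measure//; exact: measurableI.
have bf : b \is a fin_num by rewrite fin_num_measure//; exact: measurableI.
have a0 : (0 <= a)%E by exact: measure_ge0.
have b0 : (0 <= b)%E by exact: measure_ge0.
rewrite -(fineK af) -(fineK bf).
rewrite -!EFinM -!EFinD lee_fin.
have {}a0 := fine_ge0 a0; have {}b0 := fine_ge0 b0.
have := lipG y01 x01; rewrite (@ger0_norm _ (y - x)) ?subr_ge0// => Gxy.
have /(ler_wpM2r b0) := le_trans (ler_norm _) Gxy.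
have : (y - x) * fine a <= L * (y - x) * fine a.
  by rewrite ler_wpM2r// ler_peMl// subr_ge0.
lra.
Qed.

Lemma pvalue_just_above_threshold_le t (lam : Omega -> R) (e : R) : 0 < e ->
  (forall w, 0 <= lam w <= 1) ->
  (forall c, sigma_phist p t [set w | lam w <= c]) ->
  (P [set w | (lam w < p t w <= Num.min 1 (lam w + e))%R] <= (2 * L * e)%:E)%E.
Proof.
move=> e0 lam01 slam.
have e1 : 0 <= 1 / e by rewrite divr_ge0// ltW.
(* [N] cells of width [e] cover the unit interval; the first inequality ensures that the last cell
   still starts at or below [1]. *)
have [N [Ne_le Ne_ge]] : exists N : nat, N%:R * e - e <= 1 /\ 1 <= N%:R * e.
  exists (Num.truncn (1 / e)).+1; split.
    rewrite -[X in _ - X]mul1r -mulrBl -natr1 addrK -ler_pdivlMr//.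
    by rewrite truncn_le.
  by rewrite -ler_pdivrMr// ltW// truncnS_gt.
(* Only the conditional law given an event is available, so the random threshold
   [lam] is localised on the grid [e * nat]; on [A j] both [lam] and [lam + e] are
   replaced by the grid points below and above. *)
pose A j := [set w | lam w <= j%:R * e] `\` [set w | lam w <= j%:R * e - e].
have sA j : sigma_phist p t (A j) by exact: sigma_phistD.
have mA j : measurable (A j) by exact: sigma_phist_measurable (sA j).
(* Disjointness makes the probabilities of the cells sum to at most [1], so the final bound does not
   depend on [N]. *)
have tA : trivIset setT A.
  apply/trivIsetP => /= i j _ _; wlog ij : i j / (i < j)%N.
    move=> h; rewrite neq_lt => /orP[] ?; last rewrite setIC; apply: h => //.
      by rewrite lt_eqF.
    by rewrite lt_eqF.
  move=> _; apply/seteqP; split => // w /= [[wi _] [_ wj]]; apply: wj.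
  apply: (le_trans wi); rewrite -[X in _ - X]mul1r -mulrBl ler_wpM2r ?(ltW e0)//.
  by rewrite lerBrDr natr1 ler_nat.
(* The endpoints are clipped to the unit interval, where the conditional law is specified. *)
pose x j : R := Num.max 0 (j%:R * e - e).
pose y j : R := Num.min 1 (j%:R * e + e).
pose B j := A j `&` [set w | (x j < p t w <= y j)%R].
have xy j : (j <= N)%N -> x j <= y j.
  move=> jN; have jNe : j%:R * e <= N%:R * e by rewrite ler_wpM2r ?ler_nat// ltW.
  have j0 : 0 <= j%:R * e by rewrite mulr_ge0// ltW.
  by rewrite /x /y ge_max !le_min ler01 /=; lra.
have mB j : measurable (B j).
  apply: measurableI => //; apply: measurable_set_bool.
  by apply: measurable_and; [exact: measurable_fun_ltr|exact: measurable_fun_ler].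
have mlam : measurable_fun setT lam.
  apply: measurable_fun_of_le => c; exact: sigma_phist_measurable (slam c).
apply: (@le_trans _ _ (\sum_(j < N.+1) P (B j))%E).
  apply: content_subadditive => //.
    apply: measurable_set_bool; apply: measurable_and.
      exact: measurable_fun_ltr.
    apply: measurable_fun_ler => //; apply: measurable_minr => //.
    exact: measurable_funD.
  move=> w /= /andP[lp pl].
  have lamN : exists j : nat, lam w <= j%:R * e.
    by exists N; rewrite (le_trans _ Ne_ge)//; case/andP: (lam01 w).
  (* Minimality of [j] gives the strict lower bound [j * e - e < lam w]; for [j = 0] it comes from
     [0 <= lam w] instead. *)
  have [j lamj jmin] := ex_minnP lamN.
  have jN : (j <= N)%N.
    by apply: jmin; rewrite (le_trans _ Ne_ge)//; case/andP: (lam01 w).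
  rewrite -bigcup_mkord; exists j => //=.
  have lj : j%:R * e - e < lam w.
    case: j lamj jmin {jN} => [|j] _ jmin.
      by rewrite mul0r sub0r (lt_le_trans (y := 0))// ?oppr_lt0//; case/andP: (lam01 w).
    rewrite -[X in _ - X]mul1r -mulrBl -natr1 addrK ltNge.
    by apply/negP => /jmin; rewrite ltnn.
  split; first by split=> //; apply/negP; rewrite -ltNge.
  have /andP[l0 l1] := lam01 w.
  move: pl lamj; rewrite /x /y /= gt_max !le_min => /andP[-> pl] lamj /=.
  by apply/andP; split; [apply/andP; split|]; lra.
apply: (@le_trans _ _ (\sum_(j < N.+1) (2 * L * e)%:E * P (A j))%E).
  apply: lee_sum => j _.
  apply: (le_trans (@pvalue_in_interval_le t (A j) (x j) (y j) _ _ _ _)) => //.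
  - exact: sub_sigma_phist_past.
  - by rewrite /x le_max lexx.
  - by apply: xy; rewrite -ltnS.
  - by rewrite /y ge_min lexx.
  apply: lee_wpmul2r; first exact: measure_ge0.
  (* The factor [2] is the width of the enlarged cell, from [j * e - e] to [j * e + e]. *)
  rewrite lee_fin -mulrA mulrCA ler_wpM2l ?(le_trans ler01)//.
  have : x j >= j%:R * e - e by rewrite le_max lexx orbT.
  have : y j <= j%:R * e + e by rewrite ge_min lexx orbT.
  lra.
rewrite -ge0_sume_distrr; last by move=> i _; exact: measure_ge0.
rewrite -measure_bigsetU//.
rewrite -[leRHS]mule1; apply: lee_wpmul2l; first by rewrite lee_fin mulr_ge0 ?(ltW e0)// mulr_ge0// (le_trans ler01).
apply: probability_le1; apply: bigsetU_measurable => //.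
Qed.
End data_model.

(** * Uniform marginals and the comparison of FDRs *)

Section expectations.
Context (R : realType) (d : measure_display) (Omega : measurableType d).
Context (P : probability Omega R).

(** Set the earlier bounds to [1] in the joint law: the event [C] on which they hold has probability
    [1], so intersecting with it does not change the probability of [Z i <= c]. *)
Lemma independent_uniform_marginal (Z : nat -> Omega -> R) (i : nat) (c : R) :
  (forall t, measurable_fun setT (Z t)) ->
  (forall n (x : nat -> R), (forall i, 0 <= x i <= 1) ->
    P (\big[setI/setT]_(i < n) [set w | Z i w <= x i]) =
      (\prod_(i < n) x i)%:E) ->
  0 <= c <= 1 -> P [set w | Z i w <= c] = c%:E.
Proof.
move=> mZ iidZ c01.
pose C := \big[setI/setT]_(j < i) [set w | Z j w <= 1].
have mC : measurable C.
  by apply: bigsetI_measurable => j _; exact: measurable_le_cst.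
have PC : P C = 1%:E.
  by rewrite /C (iidZ i (fun=> 1)) ?big1// => j; rewrite ler01 lexx.
have mZc : measurable [set w | Z i w <= c] by exact: measurable_le_cst.
have xcE := iidZ i.+1 (fun j => if (j == i)%N then c else 1).
rewrite !big_ord_recr/= eqxx in xcE.
have eqC : \big[setI/setT]_(j < i) [set w | Z j w <= if j == i :> nat then c else 1] = C.
  by apply: eq_bigr => j _; rewrite ltn_eqF.
rewrite eqC big1 ?mul1r in xcE; last by move=> j _; rewrite ltn_eqF.
have -> : P [set w | Z i w <= c] =
    (P ([set w | (Z i w <= c)%R] `\` C) + P (C `&` [set w | (Z i w <= c)%R]))%E.
  by rewrite setIC; exact: measureDI.
rewrite xcE; last by move=> j; case: ifP; rewrite ?ler01 ?lexx.
rewrite (_ : P (_ `\` _) = 0%E) ?add0e//.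
apply/eqP; rewrite eq_le measure_ge0 andbT.
have : P (~` C) = 0%E by rewrite probability_setC// PC subee.
move=> <-; apply: le_measure; rewrite ?inE; [exact: measurableD|exact: measurableC|].
by move=> w [].
Qed.

Lemma uniform_ae_in01 (U : Omega -> R) : measurable_fun setT U ->
  (forall c, 0 <= c <= 1 -> P [set w | U w <= c] = c%:E) ->
  {ae P, forall w, 0 <= U w <= 1}.
Proof.
move=> mU unifU.
have m c : measurable [set w | U w <= c] by exact: measurable_le_cst.
(* Including [U w = 0] in the exceptional set costs nothing and lets the CDF be read off directly at
   [0] and [1]. *)
exists ([set w | U w <= 0] `|` ~` [set w | U w <= 1]); split.
- by apply: measurableU => //; exact: measurableC.
- apply/eqP; rewrite eq_le measure_ge0 andbT.
  have <- : (P [set w | (U w <= 0)%R] + P (~` [set w | (U w <= 1)%R]) = 0)%E.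
    by rewrite probability_setC// !unifU ?lexx ?ler01// subee// adde0.
  by apply: measureU2 => //; exact: measurableC.
- move=> w /= /negP; rewrite negb_and -!ltNge => /orP[/ltW|]; first by left.
  by move=> U1; right => /=; apply/negP; rewrite -ltNge.
Qed.

(** Integrates [FDP_superset]. The inclusion of rejections is required only almost everywhere, since
    the exploration variables lie in the unit interval only almost surely. *)
Lemma expectation_FDP_superset (Y delta delta' : nat -> Omega -> bool)
    (n : nat) (c : R) : 0 < c ->
  (forall s, measurable_fun setT (Y s)) ->
  (forall s, measurable_fun setT (delta s)) ->
  (forall s, measurable_fun setT (delta' s)) ->
  {ae P, forall w, forall s, delta s w -> delta' s w} ->
  (expectation P (fun w => FDP (Y ^~ w) (delta' ^~ w) n) <=
   expectation P (fun w => FDP (Y ^~ w) (delta ^~ w) n)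
   + c^-1%:E * \sum_(s < n) P [set w | ~~ delta s w && delta' s w]
   + P [set w | ((nrej (delta ^~ w) n)%:R < c)%R])%E.
Proof.
move=> c0 mY md md' dd'; rewrite unlock.
pose E s := [set w | ~~ delta s w && delta' s w].
have mE s : measurable (E s).
  by apply: measurable_set_bool; apply: measurable_and => //; exact: measurable_neg.
pose F := [set w | ((nrej (delta ^~ w) n)%:R < c)%R].
have mF : measurable F.
  apply: measurable_set_bool; apply: measurable_fun_ltr => //.
  apply: (@measurableT_comp _ _ _ _ _ _ (fun k : nat => k%:R : R)) => //.
  exact: measurable_nrej.
have mB : measurable_fun setT (fun w => (FDP (Y ^~ w) (delta ^~ w) n : R)%:E).
  by apply/measurable_EFinP; exact: measurable_FDP.
have mS : measurable_fun setT (fun w => \sum_(s < n) (\1_(E s) w : R)%:E)%E.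
  by apply: emeasurable_sum => s; apply/measurable_EFinP; exact: measurable_indic.
have mcS : measurable_fun setT
    (fun w => c^-1%:E * \sum_(s < n) (\1_(E s) w : R)%:E)%E.
  exact: emeasurable_funM.
have mF1 : measurable_fun setT (fun w => (\1_F w : R)%:E).
  by apply/measurable_EFinP; exact: measurable_indic.
have S0 w : (0 <= \sum_(s < n) (\1_(E s) w : R)%:E)%E by exact: sume_ge0.
have cS0 w : (0 <= c^-1%:E * \sum_(s < n) (\1_(E s) w : R)%:E)%E.
  by rewrite mule_ge0// lee_fin invr_ge0 ltW.
have B0 w : (0 <= (FDP (Y ^~ w) (delta ^~ w) n : R)%:E)%E by rewrite lee_fin FDP_ge0.
apply: (@le_trans _ _ (\int[P]_w ((FDP (Y ^~ w) (delta ^~ w) n : R)%:E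
   + c^-1%:E * \sum_(s < n) (\1_(E s) w : R)%:E + (\1_F w : R)%:E))%E).
  apply: ae_ge0_le_integral => //.
  - by move=> w _; rewrite lee_fin FDP_ge0.
  - by apply/measurable_EFinP; exact: measurable_FDP.
  - by move=> w _; rewrite !adde_ge0.
  - by do 2 apply: emeasurable_funD => //.
  apply: filterS dd' => w dw _.
  rewrite sumEFin -EFinM -!EFinD lee_fin.
  have := @FDP_superset R (Y ^~ w) (delta ^~ w) (delta' ^~ w) n c c0 dw.
  congr (_ <= _ + _ * _ + _).
    by apply: eq_bigr => s _; rewrite indicE /E mem_setE.
  by rewrite indicE /F mem_setE.
rewrite ge0_integralD//; [|by move=> w _; rewrite adde_ge0|exact: emeasurable_funD].
rewrite ge0_integralD// ge0_integralZl//; last by rewrite lee_fin invr_ge0 ltW.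
rewrite ge0_integral_sum//; last by move=> s; apply/measurable_EFinP; exact: measurable_indic.
rewrite integral_indic// setIT.
by under eq_bigr do rewrite integral_indic// setIT.
Qed.

End expectations.

(** * Positivity and decay of the exploration amplitude *)

Lemma eps_t_gt0 (R : realType) (kappa alpha : R) (t : nat) :
  0 < kappa -> 0 < alpha -> 0 < eps_t kappa alpha t.
Proof. by move=> k0 a0; rewrite /eps_t divr_gt0 ?mulr_gt0// sqrtr_gt0. Qed.

Lemma cvg_eps_t (R : realType) (kappa alpha : R) :
  eps_t kappa alpha t @[t --> \oo] --> 0.
Proof.
rewrite -[X in _ --> X](mulr0 (kappa * alpha)) -[X in _ * X]sqrtr0.
apply: cvgMr; rewrite (_ : (fun t => _) = Num.sqrt \o (@harmonic R)); last first.
  by apply/funext => t; rewrite /= sqrtrV.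
exact: (cvg_comp _ _ (@cvg_harmonic R) (@sqrt_continuous R 0)).
Qed.

(** * Asymptotic FDR control for DOMT *)

Unset Implicit Arguments.

Theorem theorem3 (R : realType) (d : measure_display) (Omega : measurableType d)
  (P : probability Omega R)
  (Y : nat -> Omega -> bool) (p Z : nat -> Omega -> R)
  (G : R -> R) (base : base_proc R) (kappa alpha L eta : R) :
  (* parameters *)
  0 < kappa -> 0 < alpha < 1 -> 1 <= L -> 0 < eta ->
  (* G: continuous strictly increasing CDF on [0,1], G 0 = 0, G 1 = 1 *)
  {within `[0, 1]%classic, continuous (G : R -> R)} ->
  (forall x y, 0 <= x -> x < y -> y <= 1 -> G x < G y) ->
  G 0 = 0 -> G 1 = 1 ->
  (* (ii) Lipschitz *)
  (forall x y, 0 <= x <= 1 -> 0 <= y <= 1 -> `|G x - G y| <= L * `|x - y|) ->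
  (* measurability of the primitive random variables *)
  (forall t b, measurable [set w | Y t w = b]) ->
  (forall t, measurable_fun setT (p t)) ->
  (forall t, measurable_fun setT (Z t)) ->
  (* (i) and data model: conditionally on all states and the past p-values,
     p_t ~ Uniform[0,1] if Y_t = 0 and p_t ~ G if Y_t = 1 *)
  (forall t A x, sigma_past Y p t A -> 0 <= x <= 1 ->
     P (A `&` [set w | p t w <= x]) =
       (x%:E * P (A `&` [set w | Y t w = false]) +
        (G x)%:E * P (A `&` [set w | Y t w = true]))%E) ->
  (* Z_t i.i.d. Uniform[0,1], independent of (Y, p) *)
  (forall n A (x : nat -> R), sigma_all Y p A -> (forall i, 0 <= x i <= 1) ->
     P (A `&` \big[setI/setT]_(i < n) [set w | Z i w <= x i]) =
       (P A * (\prod_(i < n) x i)%:E)%E) ->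
  (* the base procedure outputs thresholds in [0,1], measurably in the history *)
  (forall t h, 0 <= base t h <= 1) ->
  (forall t c, sigma_phist p t [set w | lam_base base (p ^~ w) t <= c]) ->
  (* (iii) liminf_T R_T^base / T >= eta almost surely *)
  {ae P, forall w, (eta%:E <= limn_einf (fun T : nat =>
       ((nrej (delta_base base (p ^~ w)) T.+1)%:R / (T.+1)%:R)%:E))%E} ->
  (* base procedure controls FDR asymptotically *)
  (limn_esup (fun t : nat =>
     expectation P (fun w => FDP (Y ^~ w) (delta_base base (p ^~ w)) t)) <= alpha%:E)%E ->
  (limn_esup (fun t : nat =>
     expectation P (fun w => FDP (Y ^~ w) (delta_domt base kappa alpha (p ^~ w) (Z ^~ w)) t))
     <= alpha%:E)%E.
Proof.
move=> kappa0 /andP[alpha0 alpha1] L1 eta0 _ _ _ _ lipG mY mp mZ model iidZ.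
move=> base01 slam liminf_R limsup_base.
pose lam t w := lam_base base (p ^~ w) t.
pose db t w := delta_base base (p ^~ w) t.
pose dd t w := delta_domt base kappa alpha (p ^~ w) (Z ^~ w) t.
pose eps t := eps_t kappa alpha t.
have eps0 t : 0 < eps t by exact: eps_t_gt0.
have mlam t : measurable_fun setT (lam t).
  by apply: measurable_fun_of_le => c; exact: (sigma_phist_measurable mY mp (slam t c)).
have mdb t : measurable_fun setT (db t) by exact: (measurable_fun_ler (mp t) (mlam t)).
have mdd t : measurable_fun setT (dd t).
  apply: (measurable_fun_ler (mp t)); apply: measurable_minr => //.
  by apply: (measurable_funD (mlam t)); exact: measurable_funM.
have mYt t : measurable_fun setT (Y t).
  by apply: (measurable_fun_bool true); rewrite setTI; exact: mY.
have Z01 : {ae P, forall w, forall t, 0 <= Z t w <= 1}.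
  apply: ae_foralln => t; apply: uniform_ae_in01 => // c c01.
  apply: independent_uniform_marginal => // n x x01.
  (* The joint law of the [Z i] is the independence hypothesis with [A] the whole space. *)
  rewrite -[X in P X]setTI iidZ ?probability_setT ?mul1e//.
  have := @sigma_algebraC _ (\bigcup_t gen_past Y p t) set0; rewrite setC0; apply.
  exact: sigma_algebra0.
have dbdd : {ae P, forall w, forall s, db s w -> dd s w}.
  apply: filterS Z01 => w Zw s; rewrite /db /dd /delta_base /delta_domt /lam_domt.
  move=> plam; have /andP[Z0 _] := Zw s.
  rewrite le_min (le_trans plam)/=; last by case/andP: (base01 s (base_hist base (p ^~ w) s)).
  by rewrite (le_trans plam)// lerDl mulr_ge0// ltW.
(* Off the null set [N], [Z s w <= 1], so an extra rejection forces the p-value into the window of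
   deterministic width [eps s] above the base threshold. *)
have extra_le s : (P [set w | ~~ db s w && dd s w] <= (2 * L * eps s)%:E)%E.
  have [N [mN PN subN]] := Z01.
  pose F := [set w | lam s w < p s w <= Num.min 1 (lam s w + eps s)].
  have mF : measurable F.
    apply: measurable_set_bool; apply: measurable_and.
      exact: measurable_fun_ltr.
    apply: measurable_fun_ler => //; apply: measurable_minr => //.
    exact: measurable_funD.
  apply: (@le_trans _ _ (P F + P N)%E).
    apply: (@le_trans _ _ (P (F `|` N))); last exact: measureU2.
    apply: le_measure; rewrite ?inE.
    - by apply: measurable_set_bool; apply: measurable_and => //; exact: measurable_neg.
    - exact: measurableU.
    move=> w /= /andP[ndb ddw]; have [Nw|nNw] := pselect (N w); first by right.
    left; rewrite /F /=.
    have /andP[_ Z1] : 0 <= Z s w <= 1.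
      by apply: contrapT => nZ; apply: nNw; apply: subN => /= /(_ s).
    move: ndb ddw; rewrite /db /dd /delta_base /delta_domt /lam_domt -ltNge.
    rewrite !le_min => -> /andP[-> pZ] /=; rewrite (le_trans pZ)// lerD2l.
    by rewrite ler_piMr// ltW.
  rewrite [P N]PN adde0.
  apply: (pvalue_just_above_threshold_le mY mp L1 lipG model) => // w.
  exact: base01.
have few_T0 : (P [set w | ((nrej (db ^~ w) T.+1)%:R < eta / 2 * T.+1%:R)%R]
    @[T --> \oo] --> 0)%E.
  apply: probability_eventually_notin_cvg0.
    move=> T; apply: measurable_set_bool; apply: measurable_fun_ltr => //.
    apply: (@measurableT_comp _ _ _ _ _ _ (fun k : nat => k%:R : R)) => //.
    exact: measurable_nrej.
  apply: filterS liminf_R => w liminf_w.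
  (* Passing from [eta] to [eta / 2] makes the bound on the limit inferior strict, hence valid for
     all large [T]. *)
  have /lt_limn_einf : ((eta / 2)%:E < limn_einf (fun T : nat =>
       ((nrej (db ^~ w) T.+1)%:R / (T.+1)%:R)%:E))%E.
    by apply: lt_le_trans liminf_w; rewrite lte_fin; lra.
  apply: filterS => T; rewrite lte_fin ltr_pdivlMr ?ltr0n// => lt_nrej /=.
  by apply/negP; rewrite -leNgt ltW.
have mean0 : (2 / eta * arithmetic_mean (fun s => 2 * L * eps s) T)
    @[T --> \oo] --> (0 : R).
  rewrite -[X in _ --> X](mulr0 (2 / eta)); apply: cvgMr; apply: cesaro.
  by rewrite -[X in _ --> X](mulr0 (2 * L)); apply: cvgMr; exact: cvg_eps_t.
have FDR_le T :
  (expectation P (fun w => FDP (Y ^~ w) (dd ^~ w) T.+1) <=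
   expectation P (fun w => FDP (Y ^~ w) (db ^~ w) T.+1)
   + (2 / eta * arithmetic_mean (fun s => 2 * L * eps s) T)%:E
   + P [set w | ((nrej (db ^~ w) T.+1)%:R < eta / 2 * T.+1%:R)%R])%E.
  (* A cutoff linear in the number of rounds turns the sum of the extra-rejection bounds into a
     multiple of their arithmetic mean, which at index [T] averages [T.+1] terms. *)
  have cT0 : 0 < eta / 2 * T.+1%:R by rewrite !mulr_gt0 ?ltr0n.
  apply: (le_trans (expectation_FDP_superset T.+1 cT0 mYt mdb mdd dbdd)).
  apply: leeD => //; apply: leeD => //.
  rewrite /arithmetic_mean /series /= mulrA.
  rewrite (_ : 2 / eta * _ = (eta / 2 * T.+1%:R)^-1); last by rewrite invfM invf_div.
  rewrite EFinM; apply: lee_wpmul2l.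
    by rewrite lee_fin invr_ge0 ltW.
  by rewrite big_mkord -sumEFin; apply: lee_sum => s _.
apply/limn_esup_leP => e e0.
(* The slack [e] is split into [e / 2] for the base FDR and [e / 4] each for the mean of extra
   rejections and the event of few rejections. *)
have e20 : 0 < e / 2 by rewrite divr_gt0.
have e40 : 0 < e / 4 by rewrite divr_gt0.
have [N1 _ base_e] := (limn_esup_leP _ _).1 limsup_base _ e20.
have [N2 _ few_e] : \forall T \near \oo,
    (P [set w | ((nrej (db ^~ w) T.+1)%:R < eta / 2 * T.+1%:R)%R] <= (0 + e / 4)%:E)%E.
  by apply: (limn_esup_leP _ _).1 e40; rewrite (cvg_limn_einf_sup few_T0).2.
have [N3 _ mean_e] := cvgr_le _ mean0 _ e40.
(* The successor excludes round count [0], as [FDR_le] is stated at [T.+1]. *)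
exists (maxn N1 (maxn N2 N3)).+1 => // -[//|T] /=.
rewrite ltnS !geq_max => /and3P[T1 T2 T3].
apply: (le_trans (FDR_le T)).
rewrite (_ : alpha + e = alpha + e / 2 + e / 4 + (0 + e / 4)); last lra.
rewrite EFinD [X in (_ <= X + _)%E]EFinD; apply: leeD; last exact: few_e.
apply: leeD; last by rewrite lee_fin; exact: mean_e.
by apply: base_e => /=; exact: leqW.
Qed.
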